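(* Let $d\in\mathbb{N}$. For every $r\in\mathcal{R}$, the set $\Pi_r\subset\mathbb{R}^d\times\mathbb{R}^d$ is Lebesgue measurable and has measure $0$. Moreover, for every $x\in\mathbb{R}^d$, the set $\Phi_r(x)=\{y\in\mathbb{R}^d:(x,y)\in\Pi_r\}$ has Lebesgue measure $0$.
   Context: For $t\in\mathbb{R}$, $\|t\|$ is the distance from $t$ to $\mathbb{Z}$. Write $\mathbb{N}=\{1,2,\dots\}$. $\mathcal{R}=\{r\in\mathbb{R}^d: r_i\ge0,\ \sum_i r_i=1\}$. For $r\in\mathcal{R}$ and $x\in\mathbb{R}^d$, $\|x\|_r=(\max_{1\le i\le d}\|x_i\|^{1/r_i})^{1/d}$. $\mathcal{D}$ is the set of all non-increasing $\psi:\mathbb{N}\to\mathbb{R}_{\ge0}$ with $\sum_n\psi(n)^d=\infty$. $W(r,\psi)$ is the set of $(x,y)\in\mathbb{R}^d\times\mathbb{R}^d$ such that $\|nx+y\|_r<\psi(n)$ for infinitely many $n\in\mathbb{N}$, and $\Pi_r=\bigcap_{\psi\in\mathcal{D}}W(r,\psi)$. *)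

(* Defs.v *)
From HB Require Import structures.
From mathcomp Require Import all_boot all_order all_algebra.
From mathcomp Require Import all_classical all_reals all_analysis.
Set Implicit Arguments. Unset Strict Implicit. Unset Printing Implicit Defensive.
Import Order.TTheory GRing.Theory Num.Theory.
Local Open Scope classical_set_scope.
Local Open Scope ring_scope.

Section Defs.
Variable R : realType.

Definition distZ (t : R) : R :=
  Num.min (t - (Num.floor t)%:~R) ((Num.ceil t)%:~R - t).

Definition weight_vec (d : nat) (r : 'rV[R]_d) : Prop :=
  (forall i, 0 <= r ord0 i) /\ \sum_(i < d) r ord0 i = 1.

(* ||t||^{1/r_i}, with the limiting convention ||t||^{1/0} = 0
   (recall ||t|| <= 1/2 < 1). *)
Definition wcoord (ri t : R) : R :=
  if ri == 0 then 0 else distZ t `^ (ri^-1).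

Definition wnorm (d : nat) (r x : 'rV[R]_d) : R :=
  (\big[Num.max/0]_(i < d) wcoord (r ord0 i) (x ord0 i)) `^ ((d%:R)^-1).

(* \mathcal{D}: psi : N -> R_{>=0}, non-increasing, sum psi(n)^d = oo.
   psi is given on nat; only its values at n >= 1 matter. *)
Definition in_D (d : nat) (psi : nat -> R) : Prop :=
  (forall n, (0 < n)%N -> 0 <= psi n) /\
  (forall m n, (0 < m)%N -> (m <= n)%N -> psi n <= psi m) /\
  ((fun N => \sum_(1 <= n < N.+1) psi n ^+ d) @ \oo --> +oo).

Definition W (d : nat) (r : 'rV[R]_d) (psi : nat -> R) : set ('rV[R]_d * 'rV[R]_d) :=
  [set xy | forall N : nat, exists n : nat,
      (N < n)%N /\ wnorm r (n%:R *: xy.1 + xy.2) < psi n].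

Definition Pi (d : nat) (r : 'rV[R]_d) : set ('rV[R]_d * 'rV[R]_d) :=
  [set xy | forall psi, in_D d psi -> W r psi xy].

Definition Phi (d : nat) (r x : 'rV[R]_d) : set 'rV[R]_d :=
  [set y | Pi r (x, y)].

Definition box (n : nat) (a b : 'rV[R]_n) : set 'rV[R]_n :=
  [set z | forall i, a ord0 i <= z ord0 i <= b ord0 i].

Definition box_vol (n : nat) (a b : 'rV[R]_n) : R :=
  \prod_(i < n) (b ord0 i - a ord0 i).

Definition leb_outer (n : nat) (A : set 'rV[R]_n) : \bar R :=
  ereal_inf [set s : \bar R | exists (a b : nat -> 'rV[R]_n),
     (forall k i, a k ord0 i <= b k ord0 i) /\
     A `<=` \bigcup_k box (a k) (b k) /\
     s = (\sum_(0 <= k <oo) (box_vol (a k) (b k))%:E)%E].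

Definition leb_measurable (n : nat) (A : set 'rV[R]_n) : Prop :=
  forall E : set 'rV[R]_n,
    leb_outer E = (leb_outer (E `&` A) + leb_outer (E `&` ~` A))%E.

Definition pair_to_row (d : nat) (S : set ('rV[R]_d * 'rV[R]_d)) : set 'rV[R]_(d + d) :=
  [set z | S (lsubmx z, rsubmx z)].

End Defs.

(* Main.v *)
(* If (x, y) lies in Pi_r, test it against psi(n) = min_(1 <= m <= n) ||m x + y||_r:
   since psi(n) is at most ||n x + y||_r, this psi cannot belong to D, so
   sum psi(n)^d converges and N psi(2N)^d tends to 0.  Hence, for every c > 0 and
   all large N, y lies in the set F_N of points for which some m <= 2N satisfies
   ||m x_i + y_i|| <= (c / N)^(r_i) for all i.  Because the weights sum to 1,
   inside a fixed cube F_N is covered by boxes of total volume at most C c with C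
   independent of N, both for fixed x and jointly in (x, y).  So the liminf of
   the F_N has outer measure at most C c by continuity from below, and c is
   arbitrary. *)
Require Import Defs.
From HB Require Import structures.
From mathcomp Require Import all_boot all_order all_algebra.
From mathcomp Require Import all_classical all_reals all_analysis.
From mathcomp Require Import ring lra zify.
Import Order.TTheory GRing.Theory Num.Theory numFieldNormedType.Exports.
Local Open Scope classical_set_scope.
Local Open Scope ring_scope.

(** * Lebesgue outer measure from countable covers by closed boxes, and its measurable sets *)

Section outer_measure.
Context {R : realType} {n : nat}.
Implicit Types (a b : 'rV[R]_n) (A B : set 'rV[R]_n).

Lemma box_vol_ge0 a b :
  (forall i, a ord0 i <= b ord0 i) -> 0 <= box_vol a b.
Proof. by move=> ab; apply: prodr_ge0 => i _; rewrite subr_ge0. Qed.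

Lemma leb_outer_le A (a b : nat -> 'rV[R]_n) :
  (forall k i, a k ord0 i <= b k ord0 i) -> A `<=` \bigcup_k box (a k) (b k) ->
  (leb_outer A <= \sum_(0 <= k <oo) (box_vol (a k) (b k))%:E)%E.
Proof. by move=> ab AB; apply: ereal_inf_lbound; exists a, b. Qed.

Lemma leb_outer_ge0 A : (0 <= leb_outer A)%E.
Proof.
apply: le_ereal_inf_tmp => _ [a [b [ab [_ ->]]]].
by apply: nneseries_ge0 => k _ _; rewrite lee_fin box_vol_ge0.
Qed.

Lemma le_leb_outer : {homo @leb_outer R n : A B / A `<=` B >-> (A <= B)%E}.
Proof.
move=> A B AB; apply: ereal_inf_le_tmp.
move=> _ [a [b [ab [Bab ->]]]]; exists a, b; split=> //; split=> //.
exact: subset_trans Bab.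
Qed.

Lemma leb_outer_sigma_subadditive : sigma_subadditive (@leb_outer R n).
Proof.
(* A near-optimal cover can be chosen only for finite outer measure, so an infinite term is treated
   first. *)
move=> A; have [[i ioo]|] := pselect (exists i, leb_outer (A i) = +oo%E).
  rewrite (eseries_pinfty _ _ ioo) ?leey// => k _.
  by rewrite -ltNye (lt_le_trans _ (leb_outer_ge0 _)).
rewrite -forallNE => Aoo; apply/lee_addgt0Pr => _/posnumP[e].
apply: le_trans (epsilon_trick _ _ _) => //; last by move=> k; exact: leb_outer_ge0.
pose P k (c : (nat -> 'rV[R]_n) * (nat -> 'rV[R]_n)) :=
  [/\ forall j i, c.1 j ord0 i <= c.2 j ord0 i,
      A k `<=` \bigcup_j box (c.1 j) (c.2 j) &
      (\sum_(0 <= j <oo) (box_vol (c.1 j) (c.2 j))%:E <=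
        leb_outer (A k) + (e%:num / (2 ^ k.+1)%:R)%:E)%E].
have [G PG] : {G & forall k, P k (G k)}.
  apply: (@choice _ _ P) => k.
  have Afin : leb_outer (A k) \is a fin_num.
    by rewrite ge0_fin_numE ?leb_outer_ge0// ltey; apply/eqP/Aoo.
  have ek : 0 < e%:num / (2 ^ k.+1)%:R by [].
  have [_ [a [b [ab [Aab ->]]] /ltW]] := lb_ereal_inf_adherent ek Afin.
  by exists (a, b).
pose v i j := (box_vol ((G i).1 j) ((G i).2 j))%:E.
have v0 i j : (0 <= v i j)%E.
  by rewrite lee_fin box_vol_ge0// => l; have [+ _ _] := PG i; exact.
apply: (@le_trans _ _ (\sum_(0 <= i <oo) \sum_(0 <= j <oo) v i j)%E); last first.
  apply: lee_nneseries => i _; first by move=> _; exact: nneseries_ge0.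
  by have [_ _ +] := PG i; exact.
(* The covers of all the [A i] are merged into one sequence of boxes along a bijection from [nat] to
   pairs. *)
have /card_esym/ppcard_eqP[f] := card_nat2.
have -> : (\sum_(0 <= i <oo) \sum_(0 <= j <oo) v i j =
           \sum_(0 <= k <oo) v (f k).1 (f k).2)%E.
  rewrite [RHS]nneseries_esumT// nneseries_esumT; last first.
    by move=> i; exact: nneseries_ge0.
  under eq_esum do rewrite nneseries_esumT//.
  rewrite esum_esum//=.
  rewrite (_ : [set: nat] `*`` _ = setT); last by apply/seteqP; split.
  rewrite (reindex_esum [set: nat] _ f)//; exact: 'bij_f.
apply: leb_outer_le => [k i|z [i _ Aiz]]; first by have [+ _ _] := PG (f k).1; exact.
have [_ /(_ _ Aiz)[j _ zij] _] := PG i.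
by exists (f^-1%FUN (i, j)) => //; rewrite invK ?inE.
Qed.

Lemma leb_outer_box a b : (0 < n)%N -> (forall i, a ord0 i <= b ord0 i) ->
  (leb_outer (box a b) <= (box_vol a b)%:E)%E.
Proof.
move=> n0 ab.
(* Covers are infinite sequences, so the box is padded by one-point boxes; these have volume 0
   because [0 < n], whereas an empty product would be 1. *)
apply: (@le_trans _ _ (\sum_(0 <= k <oo) (box_vol a (if k == 0%N then b else a))%:E)%E).
  apply: leb_outer_le => [k i|z zab]; first by case: ifP.
  by exists 0%N.
rewrite nneseries_recl//=; last first.
  by move=> k; rewrite lee_fin box_vol_ge0// => i; case: ifP.
rewrite eseries_cond eseries0 ?adde0// => -[|k] //= _ _.
by rewrite /box_vol (bigD1 (Ordinal n0))//= subrr mul0r.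
Qed.

Lemma leb_outer0 : (0 < n)%N -> leb_outer (set0 : set 'rV[R]_n) = 0%E.
Proof.
move=> n0; apply/eqP; rewrite eq_le leb_outer_ge0 andbT.
apply: (@le_trans _ _ (leb_outer (box (0 : 'rV[R]_n) 0))); first exact: le_leb_outer.
apply: le_trans (leb_outer_box _ _ n0 _) _ => //.
by rewrite /box_vol (bigD1 (Ordinal n0))//= subrr mul0r.
Qed.

Definition leb_outer_measure (n0 : (0 < n)%N) :
    {outer_measure set 'rV[R]_n -> \bar R} :=
  HB.pack (@leb_outer R n) (isOuterMeasure.Build R 'rV[R]_n (@leb_outer R n)
    (leb_outer0 n0) leb_outer_ge0 le_leb_outer leb_outer_sigma_subadditive).

Definition set_coord a (i : 'I_n) (c : R) : 'rV[R]_n :=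
  \row_j if j == i then c else a ord0 j.

Lemma box_vol_split a b i c :
  box_vol a (set_coord b i c) + box_vol (set_coord a i c) b = box_vol a b.
Proof.
rewrite /box_vol (bigD1 i)//= [X in _ + X](bigD1 i)//= [RHS](bigD1 i)//=.
rewrite !mxE eqxx.
rewrite [X in _ * X + _](eq_bigr (fun j => b ord0 j - a ord0 j)); last first.
  by move=> j /negPf ji; rewrite mxE ji.
rewrite [X in _ + _ * X = _](eq_bigr (fun j => b ord0 j - a ord0 j)); last first.
  by move=> j /negPf ji; rewrite mxE ji.
by rewrite -mulrDl addrC addrA subrK.
Qed.

(* Covers both the open and the closed halfspace. *)
Lemma caratheodory_halfspace A i t : (0 < n)%N ->
  A `<=` [set z | z ord0 i <= t] -> ~` A `<=` [set z | t <= z ord0 i] ->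
  (@leb_outer R n).-caratheodory A.
Proof.
move=> n0 At tA; apply: (@le_caratheodory_measurable _ _ (leb_outer_measure n0)).
move=> X; apply: le_ereal_inf_tmp => _ [a [b [ab [Xab ->]]]].
(* Clamping [t] to the side of the box keeps both pieces genuine boxes, even when the hyperplane
   misses the box. *)
pose c k := Num.max (a k ord0 i) (Num.min (b k ord0 i) t).
have ac k : a k ord0 i <= c k by rewrite le_max lexx.
have cb k : c k <= b k ord0 i by rewrite ge_max ab ge_min lexx.
have acb k j : a k ord0 j <= set_coord (b k) i (c k) ord0 j.
  by rewrite mxE; case: eqP => [->|_].
have cab k j : set_coord (a k) i (c k) ord0 j <= b k ord0 j.
  by rewrite mxE; case: eqP => [->|_].
under eq_eseriesr => k _ do rewrite -(box_vol_split _ _ i (c k)) EFinD.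
rewrite nneseriesD; [|by move=> *; rewrite lee_fin box_vol_ge0..].
apply: leeD; apply: leb_outer_le => // z [/Xab[k _ zk] Az]; exists k => // j; rewrite mxE.
  case: eqP => [->|_]; last exact: zk.
  have /andP[-> zb] := zk i.
  by rewrite le_max le_min zb At ?orbT.
case: eqP => [->|_]; last exact: zk.
have /andP[az ->] := zk i.
by rewrite andbT ge_max az ge_min (tA _ Az) orbT.
Qed.

(** A box is an intersection of slabs, each the difference of a closed and an open halfspace. Slabs
    are indexed by all of [nat], those beyond the dimension being the whole space. *)
Lemma caratheodory_box a b : (0 < n)%N -> (@leb_outer R n).-caratheodory (box a b).
Proof.
move=> n0; pose mu := leb_outer_measure n0.
pose slab k := [set z : 'rV[R]_n | forall i : 'I_n, i = k :> nat ->
  a ord0 i <= z ord0 i <= b ord0 i].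
have -> : box a b = \bigcap_k slab k.
  apply/seteqP; split=> [z zab k _ i _|z zs i]; first exact: zab.
  exact: (zs i).
suff : mu.-cara.-measurable (\bigcap_k slab k) by [].
apply: bigcapT_measurable => k.
have [kn|nk] := ltnP k n; last first.
  rewrite (_ : slab k = setT); first exact: measurableT.
  by apply/seteqP; split => // z _ i ik; have := ltn_ord i; rewrite ik ltnNge nk.
pose i := Ordinal kn.
rewrite (_ : slab k = [set z | z ord0 i <= b ord0 i] `\` [set z | z ord0 i < a ord0 i]).
  apply: measurableD.
    apply: (@caratheodory_halfspace _ i (b ord0 i)) => // z /= /negP.
    by rewrite -ltNge => /ltW.
  apply: (@caratheodory_halfspace _ i (a ord0 i)) => // z /=; first exact: ltW.
  by move=> /negP; rewrite -leNgt.
apply/seteqP; split=> z.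
  by move=> /(_ i erefl)/andP[az zb]; split => //=; apply/negP; rewrite -leNgt.
move=> /= [zb /negP]; rewrite -leNgt => az j jk.
by rewrite (_ : j = i) ?az ?zb//; exact: val_inj.
Qed.

(** The tail intersections increase with [K], and each lies in [F K]; continuity from below on
    Carathéodory sets passes the bound to their union. *)
Lemma leb_outer_liminf (F : nat -> set 'rV[R]_n) (e : \bar R) : (0 < n)%N ->
  (forall k, (@leb_outer R n).-caratheodory (F k)) ->
  (forall k, leb_outer (F k) <= e)%E ->
  (leb_outer (\bigcup_K \bigcap_(k in [set k | (K <= k)%N]) F k) <= e)%E.
Proof.
move=> n0 mF Fe; pose mu := leb_outer_measure n0.
pose G K := \bigcap_(k in [set k | (K <= k)%N]) F k.
have mG K : mu.-cara.-measurable (G K) by apply: bigcap_measurable => [|k _]; [exists K => /= | exact: mF].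
have GS : nondecreasing_seq G.
  by move=> K L KL; apply/subsetPset => z GKz k /= Lk; apply: GKz; exact: leq_trans Lk.
have mUG : mu.-cara.-measurable (\bigcup_K G K) by exact: bigcup_measurable.
have cG := @nondecreasing_cvg_mu _ (caratheodory_type mu) R mu G mG mUG GS.
rewrite -[leLHS](cvg_lim _ cG)//.
apply: lime_le; first by apply/cvg_ex; eexists; exact: cG.
apply: nearW => K /=; apply: le_trans (Fe K).
by apply: le_leb_outer => z GKz; exact: (GKz K (leqnn K)).
Qed.

Lemma leb_measurable_null A : (0 < n)%N -> leb_outer A = 0%E -> leb_measurable A.
Proof.
move=> n0 A0.
apply: (@le_caratheodory_measurable _ _ (leb_outer_measure n0)) => X.
rewrite -[leRHS]add0e leeD//; last by apply: le_leb_outer; exact: subIsetl.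
by rewrite -A0; apply: le_leb_outer; exact: subIsetr.
Qed.

End outer_measure.

(** * Finite unions of boxes and a criterion for null sets *)

Definition boxes {R : realType} {n : nat} (s : seq ('rV[R]_n * 'rV[R]_n)) :
  set 'rV[R]_n := \big[setU/set0]_(e <- s) box e.1 e.2.

Section boxes.
Context {R : realType} {n : nat}.
Implicit Types (s : seq ('rV[R]_n * 'rV[R]_n)) (A : set 'rV[R]_n).

Lemma caratheodory_boxes s : (0 < n)%N ->
  (@leb_outer R n).-caratheodory (boxes s).
Proof.
move=> n0; apply: (big_ind (@leb_outer R n).-caratheodory).
- exact: (caratheodory_measurable_set0 (leb_outer_measure n0)).
- exact: (@caratheodory_measurable_setU _ _ (leb_outer_measure n0)).
- by move=> e _; exact: caratheodory_box.
Qed.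

Lemma leb_outer_boxes s : (0 < n)%N ->
  (forall e, e \in s -> forall i, e.1 ord0 i <= e.2 ord0 i) ->
  (leb_outer (boxes s) <= (\sum_(e <- s) box_vol e.1 e.2)%:E)%E.
Proof.
move=> n0; elim: s => [|e s IH] es; first by rewrite /boxes !big_nil leb_outer0.
rewrite /boxes !big_cons EFinD.
apply: le_trans (outer_measureU2 (leb_outer_measure n0) _ _) _.
apply: leeD; first by apply: leb_outer_box => //; apply: es; rewrite mem_head.
by apply: IH => f fs; apply: es; rewrite in_cons fs orbT.
Qed.

Lemma mem_boxes s e z : e \in s -> box e.1 e.2 z -> boxes s z.
Proof. by move=> es ez; rewrite /boxes -bigcup_seq; exists e. Qed.

Definition cube (B : nat) : set 'rV[R]_n := [set z | forall i, `|z ord0 i| <= B%:R].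

Lemma bigcup_cube : \bigcup_B cube B = setT.
Proof.
apply/seteqP; split => // z _; exists (\sum_i Num.bound `|z ord0 i|)%N => // i.
apply: le_trans (ltW (archi_boundP (normr_ge0 _))) _.
by rewrite ler_nat (bigD1 i)//= leq_addr.
Qed.

(** Within each cube, [A] lies in the liminf of finite box unions of volume at most [C * c]. As [C]
    may depend on the cube but not on [c], each piece is null, and countably many cubes exhaust the
    space. *)
Lemma leb_outer_null_liminf A : (0 < n)%N ->
  (forall B, exists C : R, forall c, 0 < c ->
    exists s : nat -> seq ('rV[R]_n * 'rV[R]_n), forall k,
      [/\ forall e, e \in s k -> forall i, e.1 ord0 i <= e.2 ord0 i,
          \sum_(e <- s k) box_vol e.1 e.2 <= C * c &
          forall z, A z -> cube B z ->
            exists K, forall k, (K <= k)%N -> boxes (s k) z]) ->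
  leb_outer A = 0%E.
Proof.
move=> n0 AB; apply/eqP; rewrite eq_le leb_outer_ge0 andbT.
have A0 B : leb_outer (A `&` cube B) = 0%E.
  apply/eqP; rewrite eq_le leb_outer_ge0 andbT; apply/lee_addgt0Pr => e e0.
  have [C HC] := AB B; rewrite add0e.
  (* This [c] gives [C * c <= e] whatever the sign of [C], and avoids division by zero. *)
  have [|s Hs] := HC (e / (`|C| + 1)); first by rewrite divr_gt0// ltr_wpDl.
  have : (leb_outer (\bigcup_K \bigcap_(k in [set k | (K <= k)%N]) boxes (s k)) <= e%:E)%E.
    apply: leb_outer_liminf => // k; first exact: caratheodory_boxes.
    have [sle sC _] := Hs k.
    apply: le_trans (leb_outer_boxes _ n0 sle) _; rewrite lee_fin (le_trans sC)//.
    rewrite mulrCA ler_piMr ?(ltW e0)// ler_pdivrMr ?mul1r ?ltr_wpDl//.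
    by rewrite (le_trans (ler_norm C))// lerDl.
  apply: le_trans; apply: le_leb_outer => z [Az Bz].
  have [_ _ /(_ z Az Bz)[K HK]] := Hs 0%N.
  by exists K.
rewrite -[A]setIT -bigcup_cube setI_bigcupr.
apply: le_trans (leb_outer_sigma_subadditive _) _.
by rewrite eseries0.
Qed.

End boxes.

(** * Distance to the nearest integer and weighted coordinates *)

Section distZ.
Context {R : realType}.
Implicit Types t u : R.

Lemma distZ_le t (p : int) : distZ t <= `|t - p%:~R|.
Proof.
rewrite /distZ ge_min; have [pt|tp] := leP p%:~R t.
  rewrite ger0_norm ?subr_ge0//; apply/orP; left.
  by rewrite lerD2l lerN2 ler_int floor_ge_int.
rewrite ltr0_norm ?subr_lt0// opprB; apply/orP; right.
by rewrite lerD2r ler_int ceil_le_int ltW.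
Qed.

(** The bracket on [p] is what later bounds the number of integers a cover must account for. *)
Lemma distZ_attained t : exists2 p : int,
  Num.floor t <= p <= Num.ceil t & distZ t = `|t - p%:~R|.
Proof.
have fc : Num.floor t <= Num.ceil t by rewrite -(ler_int R) (le_trans (floor_le _) (ceil_ge _)).
rewrite /distZ; case: leP => _.
  by exists (Num.floor t); rewrite ?lexx ?fc// ger0_norm// subr_ge0 floor_le.
by exists (Num.ceil t); rewrite ?lexx ?fc// distrC ger0_norm// subr_ge0 ceil_ge.
Qed.

Lemma distZ_lipschitz t u : distZ t <= distZ u + `|t - u|.
Proof.
have [p _ ->] := distZ_attained u; apply: le_trans (distZ_le t p) _.
by rewrite [leRHS]addrC -[leLHS](congr1 _ (subrKA u t _)) ler_normD.
Qed.

Lemma distZ_ge0 t : 0 <= distZ t.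
Proof. by have [p _ ->] := distZ_attained t. Qed.

Lemma distZ_le1 t : distZ t <= 1.
Proof.
rewrite (le_trans (distZ_le t (Num.floor t)))// ger0_norm ?subr_ge0 ?floor_le//.
by have := floorD1_gt t; rewrite intrD lerBlDl => /ltW.
Qed.

(** For [ri = 0] the right side is 1, which [distZ] never exceeds; otherwise raising to the power
    [ri] undoes the exponent [ri^-1]. *)
Lemma wcoord_lt (ri t e : R) : 0 <= ri -> 0 <= e -> wcoord ri t < e -> distZ t <= e `^ ri.
Proof.
move=> ri0 e0; rewrite /wcoord; case: eqP => [-> _|/eqP rin0].
  by rewrite powRr0 distZ_le1.
move=> /ltW/(ge0_ler_powR ri0); rewrite !nnegrE powR_ge0 e0 => /(_ isT isT).
by rewrite -powRrM mulVf// powRr1// distZ_ge0.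
Qed.

Lemma wcoord_ge0 (ri t : R) : 0 <= wcoord ri t.
Proof. by rewrite /wcoord; case: eqP => // _; exact: powR_ge0. Qed.

End distZ.

(** * From membership in [Pi] to approximation at every large stage *)

Section Pi.
Context {R : realType} {d : nat} (d0 : (0 < d)%N) (r : 'rV[R]_d) (wr : weight_vec r).

Lemma wnorm_lt (x : 'rV[R]_d) e : 0 <= e -> wnorm r x ^+ d < e ->
  forall i, distZ (x ord0 i) <= e `^ r ord0 i.
Proof.
move=> e0 + i; rewrite /wnorm -powR_mulrn ?powR_ge0// -powRrM mulVf ?pnatr_eq0 -?lt0n//.
have b0 : 0 <= \big[Num.max/0]_(i < d) wcoord (r ord0 i) (x ord0 i).
  by apply: (big_ind (fun u => 0 <= u)) => // [u v u0 v0|j _]; rewrite ?le_max ?u0// wcoord_ge0.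
rewrite powRr1// => xe; apply: wcoord_lt => //; first by have [] := wr.
by apply: le_lt_trans xe; exact: le_bigmax.
Qed.

(** This is where the weights summing to 1 enters: it makes the volume of the covering boxes linear
    in [c]. *)
Lemma powR_weight e : 0 < e -> \prod_(i < d) e `^ r ord0 i = e.
Proof.
move=> e0; transitivity (e `^ (\sum_(i < d) r ord0 i)); last by rewrite wr.2 powRr1// ltW.
apply/esym; apply: (big_morph (fun t => e `^ t)); last exact: powRr0.
by move=> u v; rewrite powRD// (gt_eqF e0) implybT.
Qed.

Lemma Pi_liminf x y c : 0 < c -> Pi r (x, y) -> exists K, forall N, (K <= N)%N ->
  exists m, (0 < m <= 2 * N.+1)%N /\
    forall i, distZ (m%:R * x ord0 i + y ord0 i) <= (c / N.+1%:R) `^ r ord0 i.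
Proof.
move=> c0 Pxy; pose a m := wnorm r (m%:R *: x + y).
have a0 m : 0 <= a m by exact: powR_ge0.
have aE m : wnorm r (m%:R *: x + y) = a m by [].
clearbody a.
(* The running minimum of [a]; the value at 0 is set to [a 1] so that the recursion also yields
   [psi 1 = a 1]. *)
have [psi [psi_0 psiS]] : exists psi : nat -> R, psi 0%N = a 1%N /\
    forall n, psi n.+1 = Num.min (psi n) (a n.+1).
  by exists (nat_rect (fun=> R) (a 1%N) (fun n p => Num.min p (a n.+1))).
have psia n : exists2 m, (0 < m <= n.+1)%N & psi n.+1 = a m.
  elim: n => [|n [m /andP[m0 mn] IH]]; first by exists 1%N => //; rewrite psiS psi_0 minxx.
  rewrite psiS IH; case: leP => _; last by exists n.+2; rewrite ?leqnn.
  by exists m => //; rewrite m0 leqW.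
have psi0 n : (0 < n)%N -> 0 <= psi n by case: n => // n _; have [m _ ->] := psia n.
have psi_ni m n : (m <= n)%N -> psi n <= psi m.
  elim: n => [|n IH]; first by rewrite leqn0 => /eqP ->.
  rewrite leq_eqVlt => /orP[/eqP -> //|/IH]; apply: le_trans.
  by rewrite psiS ge_min lexx.
pose S N := \sum_(1 <= n < N.+1) psi n ^+ d.
have Snd : nondecreasing_seq S.
  apply/nondecreasing_seqP => N; rewrite /S [leRHS]big_nat_recr//= lerDl.
  by rewrite exprn_ge0 ?psi0.
(* If the partial sums diverged, [psi] would be in the class tested by [Pi], giving some [n] with
   [a n < psi n], against [psi n <= a n]. *)
have cS : cvgn S.
  apply: contrapT => /(nondecreasing_dvgn_lt Snd) Soo.
  have [|n [n0]] := Pxy psi _ 0%N; first by split; [|split] => // m n _; exact: psi_ni.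
  by case: n n0 => // n _; rewrite /= aE psiS lt_min ltxx andbF.
have [K _ HK] : \forall N \near \oo, limn S - c < S N.
  apply: (cvgr_gt _ cS); by rewrite ltrBlDr ltrDl.
exists K => N KN.
have := psia (2 * N.+1).-1; rewrite prednK ?muln_gt0// => -[m mN psim].
exists m; split => // i.
have /(_ _ _ i) := @wnorm_lt (m%:R *: x + y) (c / N.+1%:R); rewrite !mxE; apply.
  by rewrite divr_ge0 // ltW.
have {}HK : limn S - c < S N.+1 by apply: HK => /=; exact: leqW.
have Sl : S (2 * N.+1)%N <= limn S by exact: nondecreasing_cvgn_le.
rewrite aE -psim ltr_pdivlMr ?ltr0n//.
have : S (2 * N.+1)%N - S N.+1 < c by lra.
apply: le_lt_trans.
rewrite /S (big_cat_nat (n := N.+2))//=; last by lia.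
rewrite addrAC subrr add0r.
(* The block from [N.+2] to [2 * N.+1] has exactly [N.+1] terms, each at least the last one by
   monotonicity. *)
rewrite (_ : psi _ ^+ d * _ = \sum_(N.+2 <= n < (2 * N.+1).+1) psi (2 * N.+1)%N ^+ d).
  apply: ler_sum_nat => n /andP[Nn nN].
  by apply: lerXn2r; rewrite ?nnegrE ?psi0 ?psi_ni//; lia.
rewrite big_const_nat iter_addr_0 mulr_natr; congr (_ *+ _); lia.
Qed.

End Pi.

(** * Explicit box covers, for fixed [x] and jointly in both variables *)

Section covers.
Context {R : realType} {d : nat}.
Implicit Types (x y : 'rV[R]_d).

Lemma sum_box_vol_enum (T : finType) (bx : T -> 'rV[R]_d * 'rV[R]_d) v :
  (forall t, box_vol (bx t).1 (bx t).2 = v) ->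
  \sum_(e <- [seq bx t | t <- enum T]) box_vol e.1 e.2 = #|T|%:R * v.
Proof.
by move=> bv; rewrite big_map big_enum (eq_bigr (fun=> v))// sumr_const mulr_natl.
Qed.

(** For given [m], each [y_i] lies within [delta i] of [p - m * x_i] for an integer [p]. Since [y_i]
    is at most [B] in absolute value, [p] runs from [floor (m * x_i) - B] to
    [floor (m * x_i) + 1 + B], which is [2 * B + 2] values. *)
Lemma fiber_cover (B M : nat) (delta : 'I_d -> R) x : (forall i, 0 <= delta i) ->
  exists s : seq ('rV[R]_d * 'rV[R]_d),
  [/\ forall e, e \in s -> forall i, e.1 ord0 i <= e.2 ord0 i,
      \sum_(e <- s) box_vol e.1 e.2 =
        (M * (2 * B).+2 ^ d)%:R * \prod_(i < d) (2 * delta i) &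
      forall y m, cube B y -> (0 < m <= M)%N ->
        (forall i, distZ (m%:R * x ord0 i + y ord0 i) <= delta i) ->
        exists2 e, e \in s & box e.1 e.2 y].
Proof.
move=> delta0.
pose K := (2 * B).+2; pose T : finType := ('I_M * {ffun 'I_d -> 'I_K})%type.
pose ctr (t : T) i : R := let mx := t.1.+1%:R * x ord0 i in
  (Num.floor mx)%:~R - B%:R + (t.2 i)%:R - mx.
pose bx t := (\row_i (ctr t i - delta i) : 'rV[R]_d, \row_i (ctr t i + delta i) : 'rV[R]_d).
exists [seq bx t | t <- enum T]; split.
- by move=> _ /mapP[t _ ->] i; rewrite !mxE lerD2l (le_trans _ (delta0 i))// oppr_le0.
- rewrite (sum_box_vol_enum _ _ (\prod_(i < d) (2 * delta i))).
    by rewrite card_prod card_ffun !card_ord.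
  by move=> t; apply: eq_bigr => i _; rewrite !mxE; ring.
- move=> y [//|m] yB mM ydelta.
  have H i : exists q : 'I_K, `|m.+1%:R * x ord0 i + y ord0 i -
      ((Num.floor (m.+1%:R * x ord0 i))%:~R - B%:R + q%:R)| <= delta i.
    set mx := m.+1%:R * x ord0 i; have := ydelta i.
    have [p /andP[fp pc] ->] := distZ_attained (mx + y ord0 i) => pd.
    have /ler_normlP[yB1 yB2] := yB i.
    have f1 : Num.floor mx - B%:Z <= p.
      rewrite (le_trans _ fp)// floor_ge_int intrD mulrNz.
      by have := floor_le mx; lra.
    have f2 : p <= Num.floor mx + 1 + B%:Z.
      rewrite (le_trans pc)// ceil_le_int intrD.
      by have := floorD1_gt mx; lra.
    have qK : (absz (p - (Num.floor mx - B%:Z))%R < K)%N by rewrite /K; lia.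
    exists (Ordinal qK) => /=; apply: le_trans pd.
    rewrite (_ : _ + _%:R = p%:~R)//.
    rewrite natr_absz ger0_norm ?subr_ge0// intrB intrB; ring.
  have [q Hq] := choice H.
  exists (bx (Ordinal (mM : m < M)%N, [ffun i => q i])).
    by apply: map_f; rewrite mem_enum.
  move=> i; rewrite !mxE /ctr/= ffunE.
  by have /ler_normlP[] := Hq i => h1 h2; apply/andP; split; lra.
Qed.

Lemma cube_cover (B H : nat) : (0 < H)%N ->
  exists s : seq ('rV[R]_d * 'rV[R]_d),
  [/\ forall e, e \in s -> forall i, e.1 ord0 i <= e.2 ord0 i <= e.1 ord0 i + H%:R^-1,
      \sum_(e <- s) box_vol e.1 e.2 <= (2 * B).+1%:R ^+ d &
      forall x, cube B x -> exists2 e, e \in s & box e.1 e.2 x].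
Proof.
move=> H0; have H0' : 0 < H%:R :> R by rewrite ltr0n.
(* The extra cell per coordinate catches the endpoint [x_i = B]; since [1 <= H] it adds at most 1 to
   the total length, so the volume bound is independent of the mesh. *)
pose K := (2 * B * H).+1; pose T : finType := {ffun 'I_d -> 'I_K}.
pose bx (t : T) := (\row_i (- B%:R + (t i)%:R / H%:R) : 'rV[R]_d,
  \row_i (- B%:R + (t i)%:R / H%:R + H%:R^-1) : 'rV[R]_d).
exists [seq bx t | t <- enum T]; split.
- by move=> _ /mapP[t _ ->] i; rewrite !mxE lexx andbT lerDl invr_ge0 ltW.
- rewrite (sum_box_vol_enum _ _ (H%:R^-1 ^+ d)).
    rewrite card_ffun !card_ord natrX -exprMn; apply: lerXn2r; rewrite ?nnegrE//.
    by rewrite ler_pdivrMr// -natrM ler_nat /K; nia.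
  move=> t; rewrite /box_vol (eq_bigr (fun=> H%:R^-1)) ?prodr_const ?card_ord//.
  by move=> i _; rewrite !mxE; ring.
- move=> x xB.
  have Hq i : exists q : 'I_K, - B%:R + q%:R / H%:R <= x ord0 i <= - B%:R + q%:R / H%:R + H%:R^-1.
    have /ler_normlP[x1 x2] := xB i.
    pose u := (x ord0 i + B%:R) * H%:R.
    have u0 : 0 <= u by apply: mulr_ge0; [lra | exact: ltW].
    have f0 : 0 <= Num.floor u by rewrite floor_ge0.
    have qE : (`|Num.floor u|%N)%:R = (Num.floor u)%:~R :> R by rewrite natr_absz ger0_norm.
    have qK : (`|Num.floor u|%N < K)%N.
      rewrite ltnS -(ler_nat R) qE (le_trans (floor_le _))// natrM ler_pM2r// natrM; lra.
    exists (Ordinal qK) => /=; rewrite qE.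
    have xE : x ord0 i = - B%:R + u / H%:R by rewrite mulfK ?gt_eqF//; ring.
    rewrite xE lerD2l ler_pM2r ?invr_gt0// floor_le -addrA lerD2l/=.
    rewrite -[X in _ + X]mul1r -mulrDl ler_pM2r ?invr_gt0//.
    by have := floorD1_gt u; rewrite intrD => /ltW.
  have [q {}Hq] := choice Hq.
  exists (bx [ffun i => q i]); first by apply: map_f; rewrite mem_enum.
  by move=> i; rewrite !mxE ffunE.
Qed.

Lemma box_vol_row_mx (a b a' b' : 'rV[R]_d) :
  box_vol (row_mx a a') (row_mx b b') = box_vol a b * box_vol a' b'.
Proof.
rewrite /box_vol big_split_ord/=; congr (_ * _); apply: eq_bigr => i _.
  by rewrite !row_mxEl.
by rewrite !row_mxEr.
Qed.

(** Each grid cell in [x] is multiplied by a fiber cover over its lower corner. Fiber volumes do not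
    depend on the corner, so the total factors; the 4 combines a doubled radius with the passage
    from radius to side. *)
Lemma total_cover (B M : nat) (delta : 'I_d -> R) : (forall i, 0 < delta i) ->
  exists s : seq ('rV[R]_(d + d) * 'rV[R]_(d + d)),
  [/\ forall e, e \in s -> forall i, e.1 ord0 i <= e.2 ord0 i,
      \sum_(e <- s) box_vol e.1 e.2 <= (2 * B).+1%:R ^+ d *
        ((M * (2 * B).+2 ^ d)%:R * \prod_(i < d) (4 * delta i)) &
      forall x y m, cube B x -> cube B y -> (0 < m <= M)%N ->
        (forall i, distZ (m%:R * x ord0 i + y ord0 i) <= delta i) ->
        exists2 e, e \in s & box e.1 e.2 (row_mx x y)].
Proof.
move=> delta0.
(* The mesh 1/H is so fine that moving x inside a cell moves m x_i by at most
   delta i; hence doubling delta lets each cell use the fiber over its corner. *)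
pose H := (\sum_i Num.bound (M%:R / delta i)).+1.
have HM i : M%:R / H%:R <= delta i.
  rewrite ler_pdivrMr ?ltr0n// mulrC -ler_pdivrMr//.
  apply: le_trans (ltW (archi_boundP _)) _; first by rewrite divr_ge0// ltW.
  by rewrite ler_nat /H (bigD1 i)//= leqW// leq_addr.
have [cells [cells_le cells_vol cells_cover]] := cube_cover B H isT.
have delta2 i : 0 <= 2 * delta i by rewrite mulr_ge0 ?ltW.
have [fib Hfib] := choice (fun x => fiber_cover B M (fun i => 2 * delta i) x delta2).
exists [seq (row_mx c.1 e.1, row_mx c.2 e.2) | c <- cells, e <- fib c.1]; split.
- move=> _ /allpairsPdep[c [e [/cells_le cle ec ->]]] i /=.
  have [/(_ _ ec) ele _ _] := Hfib c.1.
  case: (split_ordP i) => j ->.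
    by rewrite !row_mxEl; have /andP[] := cle j.
  by rewrite !row_mxEr.
- rewrite big_allpairs_dep/=.
  under eq_bigr => c _.
    under eq_bigr do rewrite box_vol_row_mx.
    rewrite -mulr_sumr; have [_ -> _] := Hfib c.1.
    over.
  rewrite -mulr_suml [X in _ * (_ * X)](eq_bigr (fun i => 4 * delta i)); last by move=> i _; ring.
  apply: ler_wpM2r => //; apply: mulr_ge0 => //.
  by apply: prodr_ge0 => i _; rewrite mulr_ge0 ?ltW.
- move=> x y m xB yB mM xy.
  have [c cc cx] := cells_cover x xB.
  have [_ _ /(_ y m yB mM)[i|e ee ey]] := Hfib c.1.
    apply: le_trans (distZ_lipschitz _ (m%:R * x ord0 i + y ord0 i)) _.
    rewrite (_ : 2 * delta i = delta i + delta i); last by ring.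
    apply: lerD; first exact: xy.
    rewrite opprD addrACA subrr addr0 -mulrBr normrM ger0_norm//.
    apply: le_trans (HM i); apply: ler_pM => //.
      by rewrite ler_nat; case/andP: mM.
    have /andP[c1 c2] := cx i; have /andP[_ c3] := cells_le c cc i.
    by rewrite ler_norml; apply/andP; split; lra.
  exists (row_mx c.1 e.1, row_mx c.2 e.2); first by apply/allpairsPdep; exists c, e.
  move=> i; case: (split_ordP i) => j ->.
    by rewrite !row_mxEl.
  by rewrite !row_mxEr.
Qed.

End covers.

(** * Nullity of [Pi] and of its fibers from the two covers *)

Theorem theorem15 (R : realType) (d : nat) (hd : (0 < d)%N) (r : 'rV[R]_d) :
  weight_vec r ->
  (leb_measurable (pair_to_row (Pi r)) /\ leb_outer (pair_to_row (Pi r)) = 0%E) /\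
  (forall x : 'rV[R]_d, leb_measurable (Phi r x) /\ leb_outer (Phi r x) = 0%E).
Proof.
move=> wr.
have dd0 : (0 < d + d)%N by rewrite addn_gt0 hd.
pose delta c k i := (c / k.+1%:R) `^ r ord0 i.
(* The [2 * k.+1] choices of [m] cancel the denominator of [c / k.+1], so the bound no longer
   depends on the stage [k]. *)
have prod_delta (a c : R) k : 0 < c ->
    (2 * k.+1)%:R * \prod_(i < d) (a * delta c k i) = 2 * a ^+ d * c.
  move=> c0; rewrite big_split/= prodr_const card_ord powR_weight ?divr_gt0//.
  by rewrite natrM; field.
have delta0 c k i : 0 < c -> 0 < delta c k i by move=> c0; rewrite powR_gt0// divr_gt0.
suff [H1 H2] : leb_outer (pair_to_row (Pi r)) = 0%E /\ (forall x, leb_outer (Phi r x) = 0%E).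
  split=> [|x]; split; [|exact: H1| |exact: H2].
    exact: leb_measurable_null dd0 H1.
  exact: leb_measurable_null hd (H2 x).
split=> [|x]; apply: leb_outer_null_liminf => // B.
  (* The factors are the bound on the total cell volume, the number of integer vectors per [m], and
     the constant of [prod_delta] at [a = 4]. *)
  exists ((2 * B).+1%:R ^+ d * ((2 * B).+2 ^ d)%:R * (2 * 4 ^+ d)) => c c0.
  have [s Hs] := choice (fun k =>
    total_cover B (2 * k.+1) (delta c k) (fun i => delta0 c k i c0)).
  exists s => k; have [sle svol _] := Hs k; split => //.
    apply: le_trans svol _.
    by rewrite natrM mulrAC prod_delta// (mulrC _ _%:R) !mulrA.
  move=> z Piz zB; have [K HK] := Pi_liminf hd r wr _ _ c c0 Piz.
  exists K => j Kj; have [m [mj mz]] := HK j Kj.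
  have [_ _ /(_ (lsubmx z) (rsubmx z) m)] := Hs j.
  case=> // [i|i|e es]; [by rewrite mxE|by rewrite mxE|].
  rewrite hsubmxK; exact: mem_boxes.
exists (((2 * B).+2 ^ d)%:R * (2 * 2 ^+ d)) => c c0.
have [s Hs] := choice (fun k =>
  fiber_cover B (2 * k.+1) (delta c k) x (fun i => ltW (delta0 c k i c0))).
exists s => k; have [sle svol _] := Hs k; split => //.
  by rewrite svol natrM mulrAC prod_delta// [leLHS]mulrC !mulrA.
move=> z Piz zB; have [K HK] := Pi_liminf hd r wr _ _ c c0 Piz.
exists K => j Kj; have [m [mj mz]] := HK j Kj.
have [_ _ /(_ z m)] := Hs j.
case=> // e es; exact: mem_boxes.
Qed.
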